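(* Let $p\geq 2$. For every positive integer $n$ divisible by $(p+1)(p+2)$, there exists a $2p$-regular Hamiltonian graph on $n$ vertices which is $(p+2)$-star colourable.
   Context: A $k$-star colouring of a graph is a proper vertex colouring with $k$ colours in which no path on 4 vertices receives only two colours. *)

(* Defs.v *)
From mathcomp Require Import all_boot.

Set Implicit Arguments.
Unset Strict Implicit.
Unset Printing Implicit Defensive.

Record sgraph := SGraph {
  vertex :> finType;
  adj : rel vertex;
  adj_sym : symmetric adj;
  adj_irrefl : irreflexive adj
}.

Definition regular (G : sgraph) (d : nat) : Prop :=
  forall x : G, #|[set y : G | adj x y]| = d.

(* In a simple graph a cycle has length at least 3; [ucycle] alone would also
   accept the empty sequence and a single edge traversed back and forth. *)
Definition hamiltonian (G : sgraph) : Prop :=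
  exists s : seq G, [/\ 2 < size s, ucycle (@adj G) s & forall x : G, x \in s].

Definition proper_colouring (G : sgraph) (k : nat) (c : G -> 'I_k) : Prop :=
  forall x y : G, adj x y -> c x != c y.

(* Paths are subgraphs, not necessarily induced. *)
Definition star_colouring (G : sgraph) (k : nat) (c : G -> 'I_k) : Prop :=
  proper_colouring c /\
  forall (x : G) (s : seq G),
    path (@adj G) x s -> uniq (x :: s) -> size (x :: s) = 4 ->
    #|[set c y | y in x :: s]| != 2.

(* The palette has k colours; not all of them need be used. *)
Definition star_colourable (G : sgraph) (k : nat) : Prop :=
  exists c : G -> 'I_k, star_colouring c.

(* Main.v *)
Require Import Defs.
From mathcomp Require Import all_boot fingroup perm zify.

(* Take as vertices the arcs (i, j), i <> j, of the complete digraph on p + 2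
   points, joined when they follow each other without backtracking:
   (i, j) -> (j, k) with k <> i. This graph is 2p-regular, and colouring each arc
   by its tail makes every bicoloured component a star centred at some (i, j),
   with leaves (j, k). Both facts pass to every t-fold cover. For p > 2
   an Eulerian circuit without backtracking is a Hamiltonian cycle of the base
   (for p = 2 a cycle is given explicitly); putting the cyclic shift of order t
   on one of its edges and the identity elsewhere, it lifts to a single cycle
   through all t (p + 1) (p + 2) vertices. *)

(** * A non-backtracking Eulerian circuit of the complete digraph *)

(** For even [m], the order 1, 2, ..., m-1 has odd consecutive sums. For odd [m], the odd numbers go
    up and then the even ones down: sums are even, except (m-2) + (m-1) at the junction, which is
    not [m] since m > 3. *)
Lemma turning_order {m} (hm : 4 <= m) : exists d : nat -> nat,
  [/\ forall j, j < m.-1 -> 0 < d j < m,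
      forall j, j.+1 < m.-1 -> d j + d j.+1 != m &
      forall e, 0 < e < m -> exists2 j, j < m.-1 & d j = e].
Proof.
have [[h hE] | [h hE]] : (exists h, m = h.*2) \/ (exists h, m = h.*2.+1).
- by rewrite -(odd_double_half m); case: (odd m); [right | left]; exists m./2.
- by exists (fun j => j.+1); split=> [j|j|[|e] he] /=; [lia | lia | lia | exists e; lia].
exists (fun j => if j < h then j.*2.+1 else (m.-1 - j).*2); split.
- by move=> j; case: (ltnP j h); lia.
- by move=> j; case: (ltnP j h); case: (ltnP j.+1 h); lia.
move=> e he; have := odd_double_half e; case: (odd e) => /= eE.
  by exists e./2; last case: ltnP; lia.
by exists (m.-1 - e./2); last case: ltnP; lia.
Qed.

(** By counting, [d] takes each value 1, ..., m-1 exactly once. The sum locates the end of a lap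
    modulo [m]. *)
Lemma sum_turning_order {m} {d : nat -> nat} :
  (forall e, 0 < e < m -> exists2 j, j < m.-1 & d j = e) ->
  (\sum_(0 <= j < m.-1) d j) * 2 = m * m.-1.
Proof.
move=> d_onto.
have sub : {subset iota 1 m.-1 <= mkseq d m.-1}.
  move=> e; rewrite mem_iota => he.
  have [j hj <-] : exists2 j, j < m.-1 & d j = e by apply: d_onto; lia.
  by apply: map_f; rewrite mem_iota.
have sz : size (mkseq d m.-1) <= size (iota 1 m.-1) by rewrite size_mkseq size_iota.
have [_ eqm] := uniq_min_size (iota_uniq 1 m.-1) sub sz.
have uq := leq_size_uniq (iota_uniq 1 m.-1) sub sz.
have -> : \sum_(0 <= j < m.-1) d j = \sum_(e <- mkseq d m.-1) e.
  by rewrite big_map /index_iota subn0.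
rewrite -(perm_big _ (uniq_perm (iota_uniq 1 m.-1) uq eqm)) /=.
case: m {d d_onto sub sz eqm uq} => [|m]; first by rewrite big_nil.
have := bin2_sum m.+1; rewrite big_nat_recl // add0n => H.
have -> : \sum_(e <- iota 1 m) e = \sum_(0 <= i < m) i.+1.
  by rewrite -[1]/(1 + 0) iotaDl big_map /index_iota subn0.
rewrite H /=; have := mul_bin_diag m.+1 1; rewrite /= bin1; lia.
Qed.

Lemma eulerian_circuit {m} (hm : 4 <= m) : exists x : nat -> nat,
  [/\ forall i, x i <= m,
      forall i, x (i + m.+1 * m) = x i,
      forall i, x i != x i.+1,
      forall i, x i != x i.+2 &
      forall u v, u <= m -> v <= m -> u != v ->
        exists2 i, i < m.+1 * m & (x i, x i.+1) = (u, v)].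
Proof.
have [d [d_bnd d_turn d_onto]] := turning_order hm.
(* With [m] as a point at infinity, each lap [m, r, r + d 0, r + d 0 + d 1, ...]
   (mod [m]) uses every difference once; the [m] laps are the translates. *)
pose D k := \sum_(0 <= j < k) d j.
have DS k : D k.+1 = D k + d k by rewrite /D big_nat_recr.
have D0 : D 0 = 0 by rewrite /D big_nil.
(* Twice [D m.-1] is 0 modulo [m], while 2 is not. Hence the points [r + D m.-1] and [r + 1] on
   either side of infinity differ. *)
have Dm : D m.-1 %% m != 1 %% m.
  have := sum_turning_order d_onto; rewrite -/(D _) => H.
  apply/eqP=> /(congr1 (fun a => (a * 2) %% m)).
  by rewrite /= !modnMml H modnMr mul1n modn_small //; lia.
pose x i := if i %% m.+1 == 0 then m else (i %/ m.+1 + D (i %% m.+1).-1) %% m.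
have x0 r : x (r * m.+1) = m by rewrite /x modnMl.
have xS r k : k < m -> x (r * m.+1 + k.+1) = (r + D k) %% m.
  by move=> hk; rewrite /x modnMDl modn_small ?divnMDl ?divn_small //= addn0.
(* Serves both for one difference and for the sum of two consecutive ones. *)
have shift a e : 0 < e < m * 2 -> e != m -> a %% m != (a + e) %% m.
  move=> he em; rewrite -{1}(addn0 a) eqn_modDl mod0n eq_sym.
  by apply/negP => /dvdnP [[|[|c]]]; lia.
have m_neq a : m != a %% m.
  by rewrite eq_sym ltn_eqF // ltn_pmod; lia.
have split_i i : exists r k, k <= m /\ i = r * m.+1 + k.
  by exists (i %/ m.+1), (i %% m.+1); rewrite -divn_eq -ltnS ltn_pmod.
have next r : (r * m.+1 + m).+1 = r.+1 * m.+1 by lia.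
exists x; split.
- move=> i; rewrite /x; case: ifP => // _.
  by apply/ltnW/ltn_pmod; lia.
- move=> i; rewrite /x addnC mulnC modnMDl divnMDl //.
  by rewrite -addnA modnDl.
- move=> i; have [r [k [hk ->]]] := split_i i.
  case: k hk => [|k] hk; first by rewrite addn0 x0 -addn1 xS //; lia.
  case: (ltngtP k.+1 m) hk => // [hk _|hk _].
    rewrite -addnS !xS ?DS ?addnA; try lia.
    by have := d_bnd k; move=> h1; apply: shift; lia.
  by rewrite xS ?hk ?next ?x0 1?eq_sym //; lia.
- move=> i; have [r [k [hk ->]]] := split_i i.
  case: k hk => [|k] hk; first by rewrite addn0 x0 -addn2 xS //; lia.
  case: (ltngtP k.+1 m) hk => // [hk _|hk _]; last first.
    have -> : (r * m.+1 + k.+1).+2 = r.+1 * m.+1 + 1 by lia.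
    rewrite !xS //; try lia.
    rewrite D0 addn0 -(addn1 r) eqn_modDl.
    by have -> : k = m.-1 by lia.
  case: (ltngtP k.+2 m) hk => // [hk _|hk _]; last first.
    have -> : (r * m.+1 + k.+1).+2 = r.+1 * m.+1 by lia.
    by rewrite x0 xS 1?eq_sym //; lia.
  rewrite -!addnS !xS ?DS; try lia.
  rewrite -(addnA (D k)) (addnA r).
  have := d_turn k; have := d_bnd k; have := d_bnd k.+1.
  by move=> h2 h1 h3; apply: shift; lia.
have idx r k : r < m -> k <= m -> r * m.+1 + k < m.+1 * m.
  move=> hr hk; have : r.+1 * m.+1 <= m * m.+1 by rewrite leq_mul2r hr orbT.
  lia.
(* Among the [m] translates, some lap has [u] at a prescribed position. *)
have back u a : u < m -> exists2 r, r < m & (r + a) %% m = u.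
  move=> hu; exists ((u + (m - a %% m)) %% m); first by apply: ltn_pmod; lia.
  have ha : a %% m < m by apply: ltn_pmod; lia.
  by rewrite modnDml -modnDmr -addnA subnK 1?ltnW // modnDr modn_small.
move=> u v; rewrite (leq_eqVlt u) (leq_eqVlt v) => /predU1P [-> | hu] /predU1P [-> | hv] //.
- by rewrite eqxx.
- move=> _; exists (v * m.+1); first by have := idx v 0 hv; lia.
  by rewrite x0 -addn1 xS ?D0 ?addn0 ?modn_small //; lia.
- move=> _; have [r hr rE] := back u (D m.-1) hu.
  exists (r * m.+1 + m); first exact: idx.
  rewrite next x0; have {2}-> : m = m.-1.+1 by lia.
  by rewrite xS ?rE //; lia.
move=> huv.
(* The difference v - u fixes the position [j] in the lap; then [u] fixes the lap [r]. *)
have he : 0 < (v + (m - u)) %% m < m.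
  rewrite ltn_pmod ?andbT; last by lia.
  rewrite lt0n -/(dvdn _ _); apply/negP => /dvdnP [[|[|c]]]; lia.
have [j hj dj] := d_onto _ he.
have [r hr rE] := back u (D j) hu.
exists (r * m.+1 + j.+1); first by apply: idx => //; lia.
rewrite -addnS !xS ?DS; try lia.
rewrite rE dj addnA -modnDml rE modnDmr; congr (_, _).
rewrite (_ : u + (v + (m - u)) = v + m); last by clear -hu; lia.
by rewrite modnDr modn_small.
Qed.

(** * The Hamiltonian cycle of the base graph on arcs *)

Definition turn {T : eqType} (u v : T * T) : bool := (u.2 == v.1) && (u.1 != v.2).

(** The closing step has to be a forward turn, because it will carry the cyclic shift. *)
Lemma arc_cycle_nat {m} (hm : 3 <= m) : exists w : nat -> nat * nat,
  [/\ forall i, [/\ (w i).1 < m.+1, (w i).2 < m.+1 & (w i).1 != (w i).2],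
      forall i, w (i + m.+1 * m) = w i,
      forall i, turn (w i) (w i.+1) || turn (w i.+1) (w i),
      turn (w (m.+1 * m).-1) (w 0) &
      forall u v, u <= m -> v <= m -> u != v ->
        exists2 i, i < m.+1 * m & w i = (u, v)].
Proof.
case: (ltngtP 3 m) hm => // [hm _ | <- _].
  have [x [x_le x_per x_neq1 x_neq2 x_onto]] := eulerian_circuit hm.
  have xT i : turn (x i, x i.+1) (x i.+1, x i.+2) by rewrite /turn /= eqxx x_neq2.
  exists (fun i => (x i, x i.+1)); split=> [i|i|i||] //=.
  - by rewrite !ltnS !x_le x_neq1.
  - by rewrite -addSn !x_per.
  - by rewrite xT.
  have /prednK pos : 0 < m.+1 * m by lia.
  have := xT (m.+1 * m).-1; have := x_per 0; have := x_per 1.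
  by rewrite pos add0n add1n => -> ->.
(* For [m = 3] the complete digraph on four points has no Eulerian circuit without
   backtracking, so some steps of this cycle go against the orientation. *)
pose s := [:: (0, 1); (1, 2); (2, 0); (0, 3); (1, 0); (3, 1);
              (2, 3); (0, 2); (2, 1); (3, 2); (1, 3); (3, 0)].
pose w i := nth (0, 0) s (i %% 12).
(* Reduces each periodic claim to a computation on twelve indices. *)
have finite (P : pred nat) : all P (iota 0 12) -> forall i, P (i %% 12).
  by move=> /allP h i; apply: h; rewrite mem_iota ltn_pmod.
have wS i : w i.+1 = w (i %% 12).+1 by rewrite /w -addn1 -modnDml addn1.
have wE i : w i = w (i %% 12) by rewrite /w modn_mod.
exists w; split=> [i|i|i||u v hu hv uv] //.
- apply/and3P; rewrite wE.
  pose P k := [&& (w k).1 < 4, (w k).2 < 4 & (w k).1 != (w k).2].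
  exact: (finite P isT i).
- by rewrite /w modnDr.
- rewrite wS (wE i).
  pose P k := turn (w k) (w k.+1) || turn (w k.+1) (w k).
  exact: (finite P isT i).
exists (index (u, v) s).
  rewrite (index_mem (u, v) s).
  by case: u v hu hv uv => [|[|[|[|u]]]] [|[|[|[|v]]]].
by case: u v hu hv uv => [|[|[|[|u]]]] [|[|[|[|v]]]].
Qed.

Definition arc (q : nat) := {b : 'I_q * 'I_q | b.1 != b.2}.

Lemma arc_cycle {q} (hq : 4 <= q) : exists g : nat -> arc q,
  [/\ forall i, g (i + q * q.-1) = g i,
      forall i, turn (val (g i)) (val (g i.+1)) ||
        turn (val (g i.+1)) (val (g i)),
      turn (val (g (q * q.-1).-1)) (val (g 0)) &
      forall b, exists2 i, i < q * q.-1 & g i = b].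
Proof.
case: q hq => // m hm.
have [w [w_arc w_per w_turn w_last w_onto]] := arc_cycle_nat hm.
have w1 i : (w i).1 < m.+1 by case: (w_arc i).
have w2 i : (w i).2 < m.+1 by case: (w_arc i).
have w12 i : Ordinal (w1 i) != Ordinal (w2 i) by case: (w_arc i).
pose g i : arc m.+1 := exist _ (Ordinal (w1 i), Ordinal (w2 i)) (w12 i).
have gP i b : w i = (val (val b).1, val (val b).2) -> g i = b.
  move=> E; apply: val_inj; rewrite [RHS]surjective_pairing /=.
  by congr (_, _); apply: val_inj; rewrite /= E.
exists g; split=> [i|i||b].
- by apply: gP; rewrite w_per /= -surjective_pairing.
- exact: w_turn.
- exact: w_last.
have [i hi wi] : exists2 i, i < m.+1 * m & w i = (val (val b).1, val (val b).2).
  by apply: w_onto; [exact: leq_ord | exact: leq_ord | exact: (valP b)].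
by exists i; last exact: gP.
Qed.

Lemma card_arc q : #|{: arc q}| = q * q.-1.
Proof.
rewrite card_sig -sum1_card.
rewrite -(pair_big_dep xpredT (fun u v : 'I_q => u != v) (fun _ _ => 1)) /=.
rewrite (eq_bigr (fun=> q.-1)) => [|u _]; first by rewrite sum_nat_const card_ord.
rewrite sum1_card -[q in RHS]card_ord -(cardC1 u).
by apply: eq_card => v; rewrite !inE eq_sym.
Qed.

(** * Covers of the base graph: regularity and star colouring *)

Definition voltage (q : nat) (T : finType) := arc q -> arc q -> {perm T}.

(* Turns of the cover with fibre [T] defined by the voltages [s]. *)
Definition lift_turn {q} {T : finType} (s : voltage q T) :
    rel (arc q * T) :=
  fun x y => turn (val x.1) (val y.1) && (y.2 == s x.1 y.1 x.2).

Definition lift_adj {q} {T : finType} (s : voltage q T) :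
    rel (arc q * T) :=
  fun x y => lift_turn s x y || lift_turn s y x.

Lemma lift_adj_sym q (T : finType) (s : voltage q T) : symmetric (@lift_adj q T s).
Proof. by move=> x y; rewrite /lift_adj orbC. Qed.

Lemma lift_adj_irrefl q (T : finType) (s : voltage q T) : irreflexive (@lift_adj q T s).
Proof.
move=> [[b hb] a]; rewrite /lift_adj orbb /lift_turn /turn /=.
by rewrite eq_sym (negbTE hb).
Qed.

Definition lift_graph {q} {T : finType} (s : voltage q T) : sgraph :=
  SGraph (lift_adj_sym q T s) (lift_adj_irrefl q T s).

Lemma card_setC2 {q} {u v : 'I_q} : u != v -> #|~: [set u; v]| = q.-2.
Proof. by move=> uv; rewrite cardsCs setCK cards2 uv card_ord subn2. Qed.

Lemma arc_eq q (b c : arc q) :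
  (val b).1 = (val c).1 -> (val b).2 = (val c).2 -> b = c.
Proof.
move=> e1 e2; apply: val_inj.
by rewrite [LHS]surjective_pairing e1 e2 -surjective_pairing.
Qed.

(** A successor is determined by the head of its arc, which is any point other than the two ends of
    [x.1]. *)
Lemma card_out q (T : finType) (s : voltage q T) (x : arc q * T) :
  #|[set y | lift_turn s x y]| = q.-2.
Proof.
have hx := valP x.1.
rewrite -(card_setC2 hx) -(@card_in_imset _ _ (fun y : arc q * T => (val y.1).2)).
  apply: eq_card => v; rewrite !inE negb_or; apply/imsetP/andP => [[y]|[v1 v2]].
    rewrite inE => /andP[/andP[/eqP e ne] _] ->; rewrite eq_sym ne; split=> //.
    by rewrite e eq_sym (valP y.1).
  have hb : (val x.1).2 != v by rewrite eq_sym.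
  pose b : arc q := exist _ ((val x.1).2, v) hb.
  by exists (b, s x.1 b x.2) => //; rewrite inE /lift_turn /turn /= !eqxx eq_sym v1.
move=> [b i] [c j]; rewrite !inE /lift_turn /turn /=.
move=> /andP[/andP[/eqP eb _] /eqP ->] /andP[/andP[/eqP ec _] /eqP ->] e.
by have -> : b = c by apply: arc_eq; rewrite // -eb.
Qed.

(** Dually, the tail determines a predecessor: voltages are permutations, so its fibre coordinate
    exists and is unique. *)
Lemma card_in q (T : finType) (s : voltage q T) (x : arc q * T) :
  #|[set y | lift_turn s y x]| = q.-2.
Proof.
have hx := valP x.1.
rewrite -(card_setC2 hx) -(@card_in_imset _ _ (fun y : arc q * T => (val y.1).1)).
  apply: eq_card => v; rewrite !inE negb_or; apply/imsetP/andP => [[y]|[v1 v2]].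
    rewrite inE => /andP[/andP[/eqP e ne] _] ->; rewrite ne; split=> //.
    by rewrite -e (valP y.1).
  pose b : arc q := exist _ (v, (val x.1).1) v1.
  exists (b, (s b x.1)^-1%g x.2) => //.
  by rewrite inE /lift_turn /turn /= permKV !eqxx v2.
move=> [b i] [c j]; rewrite !inE /lift_turn /turn /=.
move=> /andP[/andP[/eqP eb _] /eqP ei] /andP[/andP[/eqP ec _] /eqP ej] e.
have bc : b = c by apply: arc_eq; rewrite // eb.
by move: ej; rewrite ei bc => /perm_inj ->.
Qed.

Lemma lift_regular q (T : finType) (s : voltage q T) :
  regular (@lift_graph q T s) (2 * q.-2).
Proof.
move=> x; rewrite /= /lift_adj.
have -> : [set y | lift_turn s x y || lift_turn s y x] =
    [set y | lift_turn s x y] :|: [set y | lift_turn s y x].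
  by apply/setP => y; rewrite !inE.
rewrite cardsU card_out card_in.
(* Turns both ways would join an arc to its reverse, which [turn] forbids. *)
have -> : [set y | lift_turn s x y] :&: [set y | lift_turn s y x] = set0.
  apply/setP => y; rewrite !inE /lift_turn /turn; apply/negP.
  case/andP => /andP[/andP[_ ne] _] /andP[/andP[/eqP e _] _].
  by rewrite e eqxx in ne.
by rewrite cards0 subn0 mul2n addnn.
Qed.

(* The second neighbour of [y] would have to point away from [z], giving it the
   colour of the head of [z], or into [z], and then the colour determines it. *)
Lemma star_centre {q} {T : finType} {s : voltage q T} {y z w : arc q * T} :
  lift_turn s y z -> lift_adj s z w ->
  (val w.1).1 = (val y.1).1 -> w = y.
Proof.
move=> /andP[/andP[/eqP yz nyz] /eqP zE] /orP[] /andP[/andP[/eqP e ne] /eqP E] c.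
  by rewrite -c -e eqxx in nyz.
have wy : w.1 = y.1 by apply: arc_eq; rewrite // yz.
have w2 : w.2 = y.2 by move: E; rewrite zE wy => /perm_inj.
by rewrite [w]surjective_pairing wy w2 -surjective_pairing.
Qed.

Lemma lift_star_colouring q (T : finType) (s : voltage q T) :
  @star_colouring (@lift_graph q T s) q (fun x => (val x.1).1).
Proof.
set G := lift_graph s; pose c (x : G) := (val x.1).1.
have proper : @proper_colouring G q c.
  move=> x y /orP[] /andP[/andP[/eqP e _] _]; rewrite /c -e; first exact: (valP x.1).
  by rewrite eq_sym; exact: (valP y.1).
split=> // x [|y [|z [|w []]]] //= /and4P[xy yz zw _] uq _.
apply/negP => /eqP card2.
(* With two colours only, colours alternate along the path. *)
have two (u v a : G) : u \in [:: x; y; z; w] -> v \in [:: x; y; z; w] ->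
    a \in [:: x; y; z; w] -> c u != c v -> c a != c v -> c a = c u.
  move=> hu hv ha uv av.
  have /eqP E : [set c u; c v] == [set c t | t in [:: x; y; z; w]].
    rewrite eqEcard card2 cards2 uv andbT.
    by apply/subsetP => _ /set2P[] ->; apply/imsetP; [exists u | exists v].
  have : c a \in [set c u; c v] by rewrite E; apply/imsetP; exists a.
  by case/set2P => // e; rewrite e eqxx in av.
have nxy := proper _ _ xy; have nyz := proper _ _ yz; have nzw := proper _ _ zw.
have xz : c x = c z by apply: (two z y) => //; rewrite ?inE ?eqxx ?orbT // eq_sym.
have wy : c w = c y by apply: (two y z) => //; rewrite ?inE ?eqxx ?orbT // eq_sym.
case/and4P: uq; rewrite !inE !negb_or => /and3P[_ nxz _] /andP[_ nyw] _ _.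
(* Depending on the orientation of the middle edge, the path folds back as [w = y] or as [x = z]. *)
case/orP: (yz) => h.
  by rewrite (star_centre h zw wy) eqxx in nyw.
have yx : lift_adj s y x by rewrite lift_adj_sym.
by rewrite (star_centre h yx xz) eqxx in nxz.
Qed.

(** * Lifting the Hamiltonian cycle to a cyclic cover *)

Lemma cycle_mkseq {T : eqType} (e : rel T) (f : nat -> T) N :
  0 < N -> f N = f 0 -> (forall i, e (f i) (f i.+1)) -> path.cycle e (mkseq f N).
Proof.
case: N => // N _ fN ef.
have -> : mkseq f N.+1 = f 0 :: mkseq (fun i => f i.+1) N.
  by rewrite /mkseq /= -[1]/(1 + 0) iotaDl -map_comp.
rewrite /= -fN.
have -> : rcons (mkseq (fun i => f i.+1) N) (f N.+1) = mkseq (fun i => f i.+1) N.+1.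
  by rewrite /mkseq -[in RHS]addn1 iotaD map_cat cats1.
rewrite fN; apply/(pathP (f 0)) => i; rewrite size_mkseq => hi.
rewrite nth_mkseq //; case: i hi => [|i] hi //=.
by rewrite nth_mkseq // ltnW.
Qed.

Theorem theorem7 (p : nat) (hp : 2 <= p) (n : nat) (hn : 0 < n)
    (hdvd : (p + 1) * (p + 2) %| n) :
  exists G : sgraph,
    [/\ #|G| = n, regular G (2 * p), hamiltonian G & star_colourable G (p + 2)].
Proof.
case/dvdnP: hdvd => t nE.
have t0 : 0 < t by case: t nE; lia.
set q := p + 2; have hq : 4 <= q by lia.
have [g [g_per g_turn g_last g_onto]] := arc_cycle hq.
set M := q * q.-1 in g_per g_last g_onto.
have M3 : 2 < M by rewrite /M; nia.
have nM : n = t * M by rewrite nE /M; congr (_ * _); rewrite /q; nia.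
(* [g] maps [M] indices onto [M] arcs. *)
have g_uniq : {in gtn M &, injective g}.
  apply/mkseq_uniqP; apply: (leq_size_uniq (enum_uniq {: arc q})).
    move=> b _; have [i hi <-] := g_onto b.
    by apply: map_f; rewrite mem_iota.
  by rewrite size_mkseq -cardE card_arc.
have gM i : g (i %% M) = g i.
  rewrite {2}(divn_eq i M); elim: (i %/ M) => [|k IH] //.
  by rewrite mulSnr addnAC g_per.
pose rot := perm (@ordS_inj t).
pose s : voltage q 'I_t := fun b c =>
  if (b == g M.-1) && (c == g 0) then rot else 1%g.
pose lap i : 'I_t := Ordinal (ltn_pmod (i %/ M) t0).
pose h i : lift_graph s := (g i, lap i).
have M_gt0 : 0 < M by lia.
have pred_lt : M.-1 < M by lia.
have step i : lift_adj s (h i) (h i.+1).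
  have hk : i %% M < M by rewrite ltn_pmod.
  (* The closing turn of each lap moves to the next sheet; all other steps stay in their sheet. *)
  have [last | nlast] := eqVneq (i %% M) M.-1.
    have iE : i.+1 = (i %/ M).+1 * M by rewrite mulSn {1}(divn_eq i M) last; lia.
    have g0 : g i.+1 = g 0 by rewrite -gM iE modnMl.
    have gl : g i = g M.-1 by rewrite -gM last.
    rewrite /lift_adj /lift_turn /= g0 gl g_last /s !eqxx /= permE.
    suff -> : lap i.+1 == ordS (lap i) by [].
    by apply/eqP/val_inj; rewrite /= {1}iE mulnK // -addn1 -modnDml addn1.
  have iE : i.+1 = i %/ M * M + (i %% M).+1 by rewrite addnS -divn_eq.
  have hk' : (i %% M).+1 < M by lia.
  have lapS : lap i.+1 = lap i.
    by apply: val_inj; rewrite /= {1}iE divnMDl // (divn_small hk') addn0.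
  have gS : g i.+1 = g (i %% M).+1 by rewrite -gM iE modnMDl modn_small.
  have s1 : s (g i) (g i.+1) = 1%g.
    rewrite /s -(gM i); case: eqP => // /g_uniq.
    by rewrite !inE hk pred_lt => /(_ isT isT) /eqP; rewrite (negbTE nlast).
  (* A backward step could meet the shifted turn only if [M] were 2. *)
  have s2 : s (g i.+1) (g i) = 1%g.
    rewrite /s gS -(gM i); case: eqP => // /g_uniq.
    rewrite !inE hk' pred_lt => /(_ isT isT) e1.
    case: eqP => // /g_uniq; rewrite !inE hk M_gt0 => /(_ isT isT); lia.
  by rewrite /lift_adj /lift_turn /= lapS s1 s2 !perm1 eqxx !andbT g_turn.
have n_card : #|lift_graph s| = n.
  by rewrite card_prod card_arc card_ord mulnC nM.
(* Lap [a] runs through the whole sheet [a]. *)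
have h_onto x : x \in mkseq h (t * M).
  case: x => b a; have [i hi gi] := g_onto b.
  apply/mapP; exists (a * M + i).
    rewrite mem_iota /= add0n.
    have : a.+1 * M <= t * M by rewrite leq_mul2r ltn_ord orbT.
    lia.
  rewrite /h -gM modnMDl modn_small // gi; congr (_, _).
  by apply: val_inj; rewrite /= divnMDl // divn_small // addn0 modn_small.
exists (lift_graph s); split=> //.
- have -> : p = q.-2 by rewrite /q addn2.
  exact: lift_regular.
- exists (mkseq h (t * M)); split=> //; first by rewrite size_mkseq; nia.
  apply/andP; split.
    apply: cycle_mkseq => //; first by rewrite muln_gt0 t0.
    (* After [t] laps the shift of order [t] has returned to sheet 0. *)
    rewrite /h -gM modnMl; congr (_, _).
    by apply: val_inj; rewrite /= mulnK // modnn div0n mod0n.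
  (* No vertex repeats, since [t * M] entries cover [t * M] vertices. *)
  apply: (leq_size_uniq (enum_uniq (lift_graph s))) => [x _|] //.
  by rewrite size_mkseq -cardE n_card nM.
- by eexists; apply: lift_star_colouring.
Qed.
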